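(* Let $n>1$ be an integer, let $s\in\mathbb{C}$, and for $r>0$ let $$\varphi(r,s)=\frac{\Gamma(\frac n2)}{\sqrt{\pi}\,\Gamma(\frac{n-1}{2})}\int_0^\pi e^{sr\cos\theta}\sin^{n-2}\theta\,d\theta .$$ If $\operatorname{Re} s>0$, then $$\varphi(r,s)\sim\frac{\Gamma(\frac n2)\,2^{\frac{n-3}{2}}}{\sqrt{\pi}}\,\frac{e^{sr}}{(sr)^{\frac{n-1}{2}}}\qquad\text{as } r\to\infty .$$
   Context: Here $\sim$ means that the ratio of the two sides tends to $1$ as $r\to\infty$ with $s$ fixed, and $(sr)^{(n-1)/2}$ is defined by the principal branch (recall $\operatorname{Re}(sr)>0$). The function $\varphi(r,s)$ is the spherical function $\varphi_s(x)=\int_{S^{n-1}}e^{s(\xi,x)}\,d\sigma(\xi)$, $r=\|x\|$, on $K\rtimes\mathbb{R}^n/K\cong\mathbb{R}^n$ for any closed subgroup $K\subset O(n)$ transitive on the spheres about $0$, where $\sigma$ is the normalized surface measure on the unit sphere $S^{n-1}$ and $(\cdot,\cdot)$ is the usual bilinear inner product. *)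

(* Defs.v *)
From Stdlib Require Export Reals.
From Stdlib Require Import Lra.
From Coquelicot Require Export Coquelicot.

Open Scope R_scope.

(** ** Complex exponential, principal logarithm and principal powers *)

Definition Cexp (z : C) : C :=
  (exp (Re z) * cos (Im z), exp (Re z) * sin (Im z)).

(** Principal argument, with values in (-PI, PI]; see [Carg_range] and
    [Cexp_Clog]. The values of [Carg], [Clog] and [Cpower] at 0 are irrelevant. *)
Definition Carg (z : C) : R :=
  if Rle_dec 0 (Im z) then acos (Re z / Cmod z) else - acos (Re z / Cmod z).

Definition Clog (z : C) : C := (ln (Cmod z), Carg z).

Definition Cpower (z a : C) : C := Cexp (a * Clog z)%C.

Lemma Cexp_Clog (z : C) : z <> RtoC 0 -> Cexp (Clog z) = z.
Proof.
intros Hz.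
assert (Hm : 0 < Cmod z) by now apply Cmod_gt_0.
assert (Hq : Cmod z ^ 2 = Re z ^ 2 + Im z ^ 2) by apply Cmod2_alt.
set (q := Re z / Cmod z).
assert (Hb : -1 <= q <= 1).
{ pose proof (re_le_Cmod z) as H. apply Rabs_le_between in H.
  unfold q; split.
  - apply Rle_div_r; lra.
  - apply Rle_div_l; lra. }
assert (Hs : sqrt (1 - Rsqr q) = Rabs (Im z) / Cmod z).
{ replace (1 - Rsqr q) with (Rsqr (Rabs (Im z) / Cmod z)).
  - apply sqrt_Rsqr. apply Rdiv_le_0_compat; [apply Rabs_pos | exact Hm].
  - unfold q; rewrite !Rsqr_div', <- Rsqr_abs.
    replace (Rsqr (Im z)) with (Rsqr (Cmod z) - Rsqr (Re z))
      by (unfold Rsqr; lra).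
    unfold Rsqr; field; lra. }
unfold Cexp, Clog; simpl.
rewrite exp_ln by exact Hm.
unfold Carg; fold q.
destruct (Rle_dec 0 (Im z)) as [Hi | Hi].
- rewrite cos_acos, sin_acos, Hs, Rabs_pos_eq by assumption.
  unfold q; destruct z as [x y]; simpl in *; f_equal; field; lra.
- rewrite cos_neg, sin_neg, cos_acos, sin_acos, Hs, Rabs_left by lra.
  unfold q; destruct z as [x y]; simpl in *; f_equal; field; lra.
Qed.

Lemma Carg_range (z : C) : z <> RtoC 0 -> - PI < Carg z <= PI.
Proof.
intros Hz.
pose proof (acos_bound (Re z / Cmod z)) as Hb.
pose proof PI_RGT_0 as Hpi.
assert (Hm : 0 < Cmod z) by now apply Cmod_gt_0.
pose proof (Cexp_Clog z Hz) as He.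
unfold Cexp, Clog in He; simpl in He.
unfold Carg in *.
destruct (Rle_dec 0 (Im z)) as [Hi | Hi]; [lra |].
destruct (Req_dec (acos (Re z / Cmod z)) PI) as [Ha | Ha]; [| lra].
rewrite Ha, sin_neg, sin_PI in He.
exfalso; apply Hi; rewrite <- He; simpl; lra.
Qed.

(** ** The Gamma function on the positive half-line *)

(** Euler's integral, improper at both ends; meaningful for [0 < x]. *)
Definition Gamma (x : R) : R :=
  RInt_gen (fun t => Rpower t (x - 1) * exp (- t))
    (at_right 0) (Rbar_locally p_infty).

(** ** The spherical function in the radial variable *)

(** The subtraction [n - 2] is truncated, hence intended for [1 < n]. *)
Definition phi (n : nat) (r : R) (s : C) : C :=
  (RtoC (Gamma (INR n / 2) / (sqrt PI * Gamma ((INR n - 1) / 2)))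
   * RInt (V := C_R_CompleteNormedModule)
       (fun theta : R =>
          Cexp (s * RtoC r * RtoC (cos theta)) * RtoC (sin theta ^ (n - 2)))
       0 PI)%C.

Definition asymp_equiv (f g : R -> C) : Prop :=
  filterlim (fun r => (f r / g r)%C)
    (Rbar_locally p_infty) (locally (T := C_UniformSpace) (RtoC 1)).

(* Main.v *)
Require Import Defs.
From Stdlib Require Import Lra Lia.

(** Write [k = n - 2], [p = (k + 1) / 2] and [s = a + i b], with [a > 0]. Dividing
    the integral by [exp (s r)] leaves
    [J = int_0^PI exp (- s r (1 - cos t)) (sin t)^k dt], and the claim becomes
    [(s r)^p J -> 2^((k - 1) / 2) Gamma p].

    Laplace's method explains the limit: only small [t] matter. The variable
    [u = 2 sqrt r sin (t / 2)] turns the exponent into exactly [- s u^2 / 2], because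
    [1 - cos t = 2 (sin (t / 2))^2]. If [(sin t)^k] is replaced by
    [(2 sin (t / 2))^k cos (t / 2)], the integral becomes the truncated Gaussian moment
    [r^(-p) int_0^(2 sqrt r) exp (- s u^2 / 2) u^k du]; as the two weights agree up to a
    relative error [O(u^2 / r)], the replacement costs [O(1 / sqrt r)]
    ([laplace_reduction]).

    It remains to see that [z^p int_0^T exp (- z u^2 / 2) u^k du] tends, as
    [T -> oo], to a number that is the same for [z = s] and for the real point
    [z = a]. Formally this is the change of contour [u -> u / sqrt z]. It is carried out
    by differentiating in the imaginary part of [z]: the derivative of the integrand is
    itself a derivative in [u], so only a boundary term of size
    [T^(k + 1) exp (- a T^2 / 2)] survives ([is_derive_normalized_moment],
    [normalized_moment_lim]). At [z = a] the substitution [t = a u^2 / 2]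
    recognizes Euler's integral ([Gamma_gauss_moment]).

    Complex quantities are handled through the real parts of their products with
    [exp (i alpha)]: the phases [alpha = 0] and [alpha = - PI / 2] give the real and the
    imaginary part, so each analytic statement is proved once for all [alpha]. *)

(** * Gaussian bounds *)

Ltac prove_continuous :=
  intros; apply (@ex_derive_continuous R_AbsRing R_NormedModule);
  auto_derive; repeat split; auto.

Lemma exp_le_exp (x y : R) : x <= y -> exp x <= exp y.
Proof.
intros [h | ->]; [now apply Rlt_le, exp_increasing | apply Rle_refl].
Qed.

(** A single factor satisfies [x <= 1 + x ^ 2 <= C exp (c x ^ 2)]; sharing the exponent
    [c] out among the [m] factors gives the general case, whence the induction over all
    [c] at once. *)
Lemma pow_le_gauss (m : nat) (c : R) (hc : 0 < c) :
  exists K, 0 < K /\ forall x, 0 <= x -> x ^ m * exp (- (c * x ^ 2)) <= K.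
Proof.
revert c hc; induction m as [| m IH]; intros c hc.
- exists 1; split; [lra |]; intros x hx.
  rewrite pow_O, Rmult_1_l, <- exp_0.
  apply exp_le_exp; nra.
- destruct (IH (c / 2)) as [K [hK H]]; [lra |].
  assert (hi : 0 < 2 / c) by (apply Rdiv_lt_0_compat; lra).
  exists ((1 + 2 / c) * K); split; [apply Rmult_lt_0_compat; nra |].
  intros x hx.
  replace (x ^ S m * exp (- (c * x ^ 2)))
    with ((x * exp (- (c / 2 * x ^ 2))) * (x ^ m * exp (- (c / 2 * x ^ 2)))).
  2: { replace (- (c * x ^ 2)) with (- (c / 2 * x ^ 2) + - (c / 2 * x ^ 2))
         by field.
       rewrite exp_plus; simpl; ring. }
  apply Rmult_le_compat.
  + apply Rmult_le_pos; [lra | apply Rlt_le, exp_pos].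
  + apply Rmult_le_pos; [now apply pow_le | apply Rlt_le, exp_pos].
  + rewrite exp_Ropp.
    apply (Rle_div_l x); [apply exp_pos |].
    apply Rle_trans with ((1 + 2 / c) * (1 + c / 2 * x ^ 2)).
    * assert (x <= 1 + x ^ 2) by nra.
      replace ((1 + 2 / c) * (1 + c / 2 * x ^ 2))
        with (1 + x ^ 2 + 2 / c + c / 2 * x ^ 2) by (field; lra).
      nra.
    * apply Rmult_le_compat_l; [nra |]. apply exp_ineq1_le.
  + now apply H.
Qed.

Lemma is_lim_0_le (f g : R -> R) :
  (forall x, 0 < x -> Rabs (f x) <= g x) -> is_lim g p_infty 0 ->
  is_lim f p_infty 0.
Proof.
intros hfg hg.
apply (is_lim_le_le_loc (fun x => - g x) g); [| | exact hg].
- exists 0; intros x hx. now apply Rabs_le_between, hfg.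
- replace (Finite 0) with (Rbar_opp 0) by (simpl; f_equal; ring).
  now apply is_lim_opp.
Qed.

Lemma is_lim_scal_inv (C : R) : is_lim (fun x => C * / x) p_infty 0.
Proof.
replace (Finite 0) with (Rbar_mult C 0) by (simpl; f_equal; ring).
apply is_lim_scal_l.
apply (is_lim_inv (fun x => x) p_infty p_infty); [apply is_lim_id | easy].
Qed.

Lemma gauss_tail_lim (m : nat) (a C : R) (ha : 0 < a) :
  is_lim (fun x => C * (x ^ m * exp (- (a * (x ^ 2 / 2))))) p_infty 0.
Proof.
destruct (pow_le_gauss (S m) (a / 2)) as [K [hK H]]; [lra |].
replace (Finite 0) with (Rbar_mult C 0) by (simpl; f_equal; ring).
apply is_lim_scal_l.
apply is_lim_0_le with (2 := is_lim_scal_inv K); intros x hx.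
rewrite Rabs_pos_eq
  by (apply Rmult_le_pos; [apply pow_le; lra | apply Rlt_le, exp_pos]).
apply (Rle_div_r _ K x); [lra |].
replace (a * (x ^ 2 / 2)) with (a / 2 * x ^ 2) by field.
specialize (H x ltac:(lra)). simpl in H |- *. lra.
Qed.

(** * Gaussian moments and the Gamma function *)

Lemma increasing_bounded_lim (F : R -> R) (B : R) :
  (forall x y, 0 <= x <= y -> F x <= F y) -> (forall x, 0 <= x -> F x <= B) ->
  exists L : R, is_lim F p_infty L /\ forall x, 0 <= x -> F x <= L.
Proof.
intros hF hB.
destruct (completeness (fun y => exists x, 0 <= x /\ y = F x)) as [L [hL1 hL2]].
- exists B; intros y [x [hx ->]]; auto.
- exists (F 0), 0; split; [lra | easy].
- assert (hL : forall x, 0 <= x -> F x <= L).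
  { intros x hx; apply hL1; exists x; auto. }
  exists L; split; [| exact hL].
  apply is_lim_spec; intros eps.
  destruct (Classical_Prop.classic (exists x, 0 <= x /\ L - eps < F x))
    as [[x0 [hx0 h]] | hn].
  + exists x0; intros x hx.
    assert (F x0 <= F x) by (apply hF; lra).
    assert (F x <= L) by (apply hL; lra).
    apply Rabs_def1; destruct eps as [e he]; simpl in *; lra.
  + exfalso.
    assert (L <= L - eps); [| destruct eps; simpl in *; lra].
    apply hL2; intros y [x [hx ->]].
    apply Rnot_lt_le; intros h; apply hn; exists x; auto.
Qed.

Definition gauss_moment (k : nat) (T : R) : R :=
  RInt (fun u => exp (- (u ^ 2 / 2)) * u ^ k) 0 T.

Lemma ex_RInt_cont (f : R -> R) (a b : R) :
  (forall x, continuous f x) -> ex_RInt f a b.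
Proof. intros H; apply (@ex_RInt_continuous R_CompleteNormedModule); auto. Qed.

Lemma continuous_gauss_integrand (k : nat) (x : R) :
  continuous (fun u => exp (- (u ^ 2 / 2)) * u ^ k) x.
Proof. prove_continuous. Qed.

(** The integrand is dominated by a multiple of [1 / (1 + u ^ 2)], whose primitive
    [atan] is bounded. *)
Lemma gauss_moment_lim (k : nat) :
  exists L : R, 0 < L /\ is_lim (gauss_moment k) p_infty L.
Proof.
destruct (pow_le_gauss k (1 / 2)) as [K0 [hK0 H0]]; [lra |].
destruct (pow_le_gauss (S (S k)) (1 / 2)) as [K2 [hK2 H2]]; [lra |].
assert (hex : forall x y,
  ex_RInt (fun u => exp (- (u ^ 2 / 2)) * u ^ k) x y).
{ intros x y; apply ex_RInt_cont, continuous_gauss_integrand. }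
assert (hpos : forall u, 0 <= u -> 0 <= exp (- (u ^ 2 / 2)) * u ^ k).
{ intros u hu; apply Rmult_le_pos; [apply Rlt_le, exp_pos | now apply pow_le]. }
destruct (increasing_bounded_lim (gauss_moment k) ((K0 + K2) * (PI / 2)))
  as [L [hL1 hL2]].
- intros x y hxy; unfold gauss_moment.
  rewrite <- (RInt_Chasles _ 0 x y) by apply hex.
  apply Rle_trans with (1 := Req_le _ _ (eq_sym (Rplus_0_r _))).
  apply Rplus_le_compat_l.
  apply RInt_ge_0; [lra | apply hex |].
  intros; apply hpos; lra.
- intros x hx.
  assert (hI : is_RInt (fun u => (K0 + K2) * / (1 + u ^ 2)) 0 x
                 ((K0 + K2) * atan x)).
  { replace ((K0 + K2) * atan x)
      with (minus ((K0 + K2) * atan x) ((K0 + K2) * atan 0))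
      by (rewrite atan_0; unfold minus, plus, opp; simpl; ring).
    apply (is_RInt_derive (fun u => (K0 + K2) * atan u)).
    - intros u _; auto_derive; [easy |]. field; nra.
    - prove_continuous. nra. }
  apply Rle_trans with ((K0 + K2) * atan x).
  + unfold gauss_moment. rewrite <- (is_RInt_unique _ _ _ _ hI).
    apply RInt_le; [lra | apply hex | eexists; apply hI |].
    intros u hu. apply (Rle_div_r _ (K0 + K2)); [nra |].
    specialize (H0 u ltac:(lra)). specialize (H2 u ltac:(lra)).
    replace (1 / 2 * u ^ 2) with (u ^ 2 / 2) in * by field.
    simpl in *. lra.
  + apply Rmult_le_compat_l; [lra |]. apply Rlt_le, atan_bound.
- exists L; split; [| exact hL1].
  apply Rlt_le_trans with (gauss_moment k 1); [| apply hL2; lra].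
  apply RInt_gt_0; [lra | | intros; apply continuous_gauss_integrand].
  intros u hu; apply Rmult_lt_0_compat; [apply exp_pos | apply pow_lt; lra].
Qed.

Lemma is_derive_gauss_moment (k : nat) (T : R) :
  is_derive (gauss_moment k) T (exp (- (T ^ 2 / 2)) * T ^ k).
Proof.
apply (is_derive_RInt (fun u => exp (- (u ^ 2 / 2)) * u ^ k)
         (gauss_moment k) 0 T).
- exists (mkposreal 1 Rlt_0_1); intros y _.
  apply (@RInt_correct R_CompleteNormedModule), ex_RInt_cont, continuous_gauss_integrand.
- apply continuous_gauss_integrand.
Qed.

Lemma sqrt_pow_Rpower (y : R) (m : nat) (hy : 0 < y) :
  sqrt y ^ m = Rpower y (INR m / 2).
Proof.
rewrite <- Rpower_pow by now apply sqrt_lt_R0.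
rewrite <- (Rpower_sqrt y hy), Rpower_mult; f_equal; field.
Qed.

Lemma sqrt_pow_div (y : R) (k : nat) (hy : 0 < y) :
  sqrt y ^ k / sqrt y = Rpower y ((INR k - 1) / 2).
Proof.
replace (sqrt y) with (Rpower y (/ 2)) at 2 by now apply Rpower_sqrt.
unfold Rdiv; rewrite sqrt_pow_Rpower, <- Rpower_Ropp, <- Rpower_plus by easy.
f_equal; field.
Qed.

(** Substituting [t = u ^ 2 / 2] in Euler's integral. For [k = 0] that integral is
    singular at [0], so the substitution is made on primitives: the function
    [t -> gauss_moment k (sqrt (2 t))], suitably scaled, is a primitive of Euler's
    integrand on the open half-line and is continuous at [0]. *)
Lemma Gamma_gauss_moment (k : nat) :
  exists L : R, 0 < L /\ is_lim (gauss_moment k) p_infty L /\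
    Gamma ((INR k + 1) / 2) * Rpower 2 ((INR k - 1) / 2) = L.
Proof.
destruct (gauss_moment_lim k) as [L [hL hlim]].
exists L; split; [exact hL | split; [exact hlim |]].
set (c := / Rpower 2 ((INR k - 1) / 2)).
assert (hp : 0 < Rpower 2 ((INR k - 1) / 2)) by apply exp_pos.
set (F := fun t => c * gauss_moment k (sqrt (2 * t))).
set (f := fun t => Rpower t ((INR k + 1) / 2 - 1) * exp (- t)).
assert (hF : forall t, 0 < t -> is_derive F t (f t)).
{ intros t ht.
  assert (hs : 0 < sqrt (2 * t)) by (apply sqrt_lt_R0; lra).
  assert (hs2 : sqrt (2 * t) ^ 2 = 2 * t) by (rewrite pow2_sqrt; lra).
  replace (f t) with
    (c * (/ sqrt (2 * t) *
       (exp (- (sqrt (2 * t) ^ 2 / 2)) * sqrt (2 * t) ^ k))).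
  - apply is_derive_scal.
    apply (is_derive_comp (gauss_moment k) (fun t => sqrt (2 * t))).
    + apply is_derive_gauss_moment.
    + auto_derive; [lra |]. field; lra.
  - rewrite hs2. replace (2 * t / 2) with t by field.
    transitivity (c * (sqrt (2 * t) ^ k / sqrt (2 * t)) * exp (- t)).
    + field; lra.
    + rewrite sqrt_pow_div by lra.
      unfold f, c. replace ((INR k + 1) / 2 - 1) with ((INR k - 1) / 2) by field.
      rewrite <- Rpower_mult_distr by lra. field; lra. }
assert (hDF : forall t, 0 < t -> Derive F t = f t).
{ intros t ht; apply is_derive_unique; auto. }
assert (hpos : filter_prod (at_right 0) (Rbar_locally p_infty)
  (fun ab : R * R => forall x, Rmin (fst ab) (snd ab) <= x <= Rmax (fst ab) (snd ab) -> 0 < x)).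
{ exists (fun x => 0 < x) (fun x => 0 < x).
  - exists (mkposreal 1 Rlt_0_1); intros y _; easy.
  - exists 0; easy.
  - intros x y hx hy z [hz _]; simpl in *.
    apply Rlt_le_trans with (2 := hz). now apply Rmin_glb_lt. }
assert (hG : Gamma ((INR k + 1) / 2) = c * L).
{ unfold Gamma. apply is_RInt_gen_unique.
  fold f.
  apply (is_RInt_gen_ext (Derive F)).
  - apply filter_imp with (2 := hpos); intros ab h x hx.
    apply hDF, h; lra.
  - replace (c * L) with (c * L - 0) by ring.
    apply is_RInt_gen_Derive.
    + apply filter_imp with (2 := hpos); intros ab h x hx.
      eexists; now apply hF, h.
    + apply filter_imp with (2 := hpos); intros ab h x hx.
      specialize (h x hx).
      apply continuous_ext_loc with f.
      * exists (mkposreal x h); intros y hy.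
        apply Rabs_def2 in hy; unfold minus, plus, opp in hy; simpl in hy.
        symmetry; apply hDF; lra.
      * unfold f, Rpower; prove_continuous.
    + replace (locally 0) with (locally (F 0)).
      2: { unfold F, gauss_moment. now rewrite Rmult_0_r, sqrt_0, RInt_point, Rmult_0_r. }
      apply (@filterlim_filter_le_1 _ _ (locally 0)).
      { intros P [d hd]; exists d; intros y hy _; auto. }
      apply (continuous_comp (fun t => sqrt (2 * t)) (fun x => c * gauss_moment k x)).
      * apply (continuous_comp (fun t => 2 * t) sqrt).
        -- prove_continuous.
        -- apply continuous_sqrt.
      * apply (@ex_derive_continuous R_AbsRing R_NormedModule).
        eexists; apply is_derive_scal, is_derive_gauss_moment.
    + change (is_lim F p_infty (Rbar_mult c L)).
      apply is_lim_scal_l.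
      apply is_lim_comp with p_infty; [exact hlim | | now exists 0].
      apply (is_lim_comp sqrt (fun t => 2 * t) p_infty p_infty p_infty).
      * apply filterlim_sqrt_p.
      * apply is_lim_spec; intros M; exists (M / 2); intros x hx; lra.
      * now exists 0. }
rewrite hG; unfold c; field; lra.
Qed.

(** * Laplace's method on the sphere *)

(** The bound on the replacement of the weight [(sin t)^k]; here [c = cos (t / 2)], and
    [1 - c ^ 2] is the square of [sin (t / 2)], which the Gaussian factor absorbs. *)
Lemma Rabs_pow_sub_le (c : R) (k : nat) (hc : 0 <= c <= 1) :
  Rabs (c ^ k - c) <= (INR k + 1) * (1 - c ^ 2).
Proof.
assert (hk : 1 - INR k * (1 - c) <= c ^ k <= 1).
{ induction k as [| k IH].
  - simpl; lra.
  - rewrite S_INR; simpl. pose proof (pos_INR k). split; nra. }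
pose proof (pos_INR k).
assert (1 - c <= 1 - c ^ 2) by nra.
apply Rabs_le; split; nra.
Qed.

(** The parameter is [rho = sqrt r]. With [w = 2 sin (t / 2)] and [c = cos (t / 2)] the
    difference of the two integrands in [t] is [rho x^k g (x^2 / 2) (c^k - c)] where
    [x = rho w]; since [1 - c^2 = w^2 / 4 = x^2 / (4 rho^2)], it is at most
    [(k + 1) / (4 rho)] times the bounded quantity [x^(k + 2) exp (- a x^2 / 2)]. *)
Lemma laplace_reduction (g : R -> R) (a : R) (k : nat) (ha : 0 < a)
  (hg : forall x, continuous g x)
  (hb : forall x, 0 <= x -> Rabs (g x) <= exp (- (a * x))) :
  is_lim (fun rho =>
      rho ^ (k + 1) * RInt (fun t => g (rho ^ 2 * (1 - cos t)) * sin t ^ k) 0 PI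
      - RInt (fun u => g (u ^ 2 / 2) * u ^ k) 0 (2 * rho)) p_infty 0.
Proof.
destruct (pow_le_gauss (k + 2) (a / 2)) as [K [hK H]]; [lra |].
set (C := (PI - 0) * ((INR k + 1) / 4 * K)).
apply is_lim_0_le with (2 := is_lim_scal_inv C); intros rho hr.
assert (hmain : RInt (fun u => g (u ^ 2 / 2) * u ^ k) 0 (2 * rho)
  = RInt (fun t => rho * cos (t / 2) *
      (g ((2 * rho * sin (t / 2)) ^ 2 / 2) * (2 * rho * sin (t / 2)) ^ k)) 0 PI).
{ pose proof (RInt_comp (V := R_CompleteNormedModule)
    (fun u => g (u ^ 2 / 2) * u ^ k)
    (fun t => 2 * rho * sin (t / 2)) (fun t => rho * cos (t / 2)) 0 PI) as hc.
  cbv beta in hc.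
  replace (2 * rho * sin (0 / 2)) with 0 in hc
    by (unfold Rdiv; rewrite Rmult_0_l, sin_0; ring).
  rewrite sin_PI2, Rmult_1_r in hc.
  symmetry; apply hc.
  - intros t _. apply (continuous_mult (fun u => g (u ^ 2 / 2)) (fun u => u ^ k)).
    + apply (continuous_comp (fun u => u ^ 2 / 2) g); [prove_continuous | apply hg].
    + prove_continuous.
  - intros t _; split; [| prove_continuous].
    auto_derive; [easy |]. change (t * / 2) with (t / 2); field. }
assert (hcg : forall f : R -> R, (forall t, ex_derive f t) ->
   forall t, continuous (fun t => g (f t)) t).
{ intros f hf t. apply (continuous_comp f g); [| apply hg].
  now apply (@ex_derive_continuous R_AbsRing R_NormedModule). }
set (f1 := fun t => g (rho ^ 2 * (1 - cos t)) * sin t ^ k).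
set (f2 := fun t => rho * cos (t / 2) *
   (g ((2 * rho * sin (t / 2)) ^ 2 / 2) * (2 * rho * sin (t / 2)) ^ k)).
assert (h1 : ex_RInt f1 0 PI).
{ apply ex_RInt_cont; intros t.
  apply (continuous_mult (fun t => g (rho ^ 2 * (1 - cos t))) (fun t => sin t ^ k)).
  - apply hcg; intros; auto_derive; easy.
  - prove_continuous. }
assert (h2 : ex_RInt f2 0 PI).
{ apply ex_RInt_cont; intros t.
  apply (continuous_mult (fun t => rho * cos (t / 2))); [prove_continuous |].
  apply (continuous_mult (fun t => g ((2 * rho * sin (t / 2)) ^ 2 / 2))
    (fun t => (2 * rho * sin (t / 2)) ^ k)).
  - apply hcg; intros; auto_derive; easy.
  - prove_continuous. }
pose proof (is_RInt_minus _ _ _ _ _ _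
  (is_RInt_scal _ _ _ (rho ^ (k + 1)) _
     (RInt_correct (V := R_CompleteNormedModule) f1 0 PI h1))
  (RInt_correct (V := R_CompleteNormedModule) f2 0 PI h2)) as hI.
assert (hE : RInt (fun t => rho ^ (k + 1) * f1 t - f2 t) 0 PI
  = rho ^ (k + 1) * RInt f1 0 PI - RInt f2 0 PI)
  by exact (is_RInt_unique _ _ _ _ hI).
rewrite hmain.
change (Rabs (rho ^ (k + 1) * RInt f1 0 PI - RInt f2 0 PI) <= C * / rho).
rewrite <- hE.
replace (C * / rho) with ((PI - 0) * ((INR k + 1) / 4 * K * / rho))
  by (unfold C; ring).
apply abs_RInt_le_const;
  [apply Rlt_le, PI_RGT_0 | eexists; exact hI |].
intros t ht.
set (c := cos (t / 2)). set (w := 2 * sin (t / 2)).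
pose proof (sin2_cos2 (t / 2)) as hsc; unfold Rsqr in hsc; fold c in hsc.
assert (hw : 0 <= w).
{ assert (0 <= sin (t / 2)) by (apply sin_ge_0; lra). unfold w; lra. }
assert (hc : 0 <= c <= 1).
{ split; [apply cos_ge_0; lra | apply COS_bound]. }
assert (hs : sin t = w * c).
{ replace t with (2 * (t / 2)) at 1 by field. apply sin_2a. }
assert (hct : 1 - cos t = w ^ 2 / 2).
{ replace t with (2 * (t / 2)) at 1 by field.
  rewrite cos_2a_sin. unfold w; field. }
unfold f1, f2; rewrite hs, hct. fold c. replace (2 * rho * sin (t / 2)) with (rho * w) by (unfold w; ring).
replace (rho ^ 2 * (w ^ 2 / 2)) with ((rho * w) ^ 2 / 2) by field.
set (x := rho * w).
assert (hx : 0 <= x) by (apply Rmult_le_pos; lra).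
replace (rho ^ (k + 1) * (g (x ^ 2 / 2) * (w * c) ^ k) -
   rho * c * (g (x ^ 2 / 2) * x ^ k))
  with (rho * x ^ k * g (x ^ 2 / 2) * (c ^ k - c)).
2: { unfold x; rewrite pow_add, !Rpow_mult_distr; ring. }
rewrite 2!Rabs_mult, (Rabs_pos_eq (rho * x ^ k))
  by (apply Rmult_le_pos; [lra | now apply pow_le]).
apply (Rle_div_r _ ((INR k + 1) / 4 * K) rho); [lra |].
apply Rle_trans with (rho * x ^ k * exp (- (a * (x ^ 2 / 2)))
   * ((INR k + 1) * (w ^ 2 / 4)) * rho).
- apply Rmult_le_compat_r; [lra |].
  apply Rmult_le_compat; [| apply Rabs_pos | |].
  + apply Rmult_le_pos; [| apply Rabs_pos].
    apply Rmult_le_pos; [lra | now apply pow_le].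
  + apply Rmult_le_compat_l.
    * apply Rmult_le_pos; [lra | now apply pow_le].
    * apply hb; nra.
  + replace (w ^ 2 / 4) with (1 - c ^ 2) by (unfold w; simpl; lra).
    now apply Rabs_pow_sub_le.
- replace (rho * x ^ k * exp (- (a * (x ^ 2 / 2)))
   * ((INR k + 1) * (w ^ 2 / 4)) * rho)
    with ((INR k + 1) / 4 * (x ^ (k + 2) * exp (- (a / 2 * x ^ 2)))).
  + pose proof (pos_INR k).
    apply Rmult_le_compat_l; [lra | now apply H].
  + replace (a * (x ^ 2 / 2)) with (a / 2 * x ^ 2) by field.
    rewrite pow_add; unfold x at 2; field.
Qed.

(** * Rotation of the Gaussian moments *)

(** For [z = a + i tau], the real part of
    [exp (i psi) int_0^T exp (- z u^2 / 2) u^k du]. *)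
Definition rotated_moment (k : nat) (psi a tau T : R) : R :=
  RInt (fun u => exp (- (a * (u ^ 2 / 2))) * cos (psi - tau * (u ^ 2 / 2)) * u ^ k)
    0 T.

(** For [z = a + i tau] and [p = (k + 1) / 2], the real part of
    [exp (i alpha) z^p int_0^T exp (- z u^2 / 2) u^k du], the principal power being
    written in polar form. *)
Definition normalized_moment (k : nat) (alpha a tau T : R) : R :=
  exp ((INR k + 1) / 2 * (ln (a ^ 2 + tau ^ 2) / 2))
  * rotated_moment k (alpha + (INR k + 1) / 2 * atan (tau / a)) a tau T.

Lemma continuity_2d_pt_fst (h : R -> R) (x y : R) :
  ex_derive h x -> continuity_2d_pt (fun u _ => h u) x y.
Proof.
intros H; apply (continuity_1d_2d_pt_comp h (fun u _ => u)).
- now apply continuity_pt_filterlim, (@ex_derive_continuous R_AbsRing R_NormedModule).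
- apply continuity_2d_pt_id1.
Qed.

Lemma continuity_2d_pt_snd (h : R -> R) (x y : R) :
  ex_derive h y -> continuity_2d_pt (fun _ v => h v) x y.
Proof.
intros H; apply (continuity_1d_2d_pt_comp h (fun _ v => v)).
- now apply continuity_pt_filterlim, (@ex_derive_continuous R_AbsRing R_NormedModule).
- apply continuity_2d_pt_id2.
Qed.

Ltac prove_continuity_2d :=
  repeat first
    [ apply continuity_2d_pt_fst; auto_derive; repeat split; auto; fail
    | apply continuity_2d_pt_snd; auto_derive; repeat split; auto; fail
    | apply continuity_2d_pt_plus | apply continuity_2d_pt_minus
    | apply continuity_2d_pt_opp | apply continuity_2d_pt_mult
    | apply (continuity_1d_2d_pt_comp cos); [apply continuity_cos |]
    | apply (continuity_1d_2d_pt_comp sin); [apply continuity_sin |] ].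

(** With [exp (i alpha)] and the real part set aside, this rests on the identity
    [d/dz (z^p exp (- z u^2 / 2) u^k) = d/du (z^(p - 1) u^(k + 1) exp (- z u^2 / 2)) / 2],
    valid because [2 p = k + 1]. Along [z = a + i tau] it gets a factor [i]; after
    integration in [u] only the value at [u = T] is left. The factor
    [tau cos Theta - a sin Theta] is the real part of [i exp (i Theta)] times the
    conjugate of [z], coming from [z^(p - 1) = z^p conj z / |z|^2]. *)
Lemma is_derive_normalized_moment (k : nat) (alpha a tau T : R) (ha : 0 < a) :
  let p := (INR k + 1) / 2 in
  let Theta := alpha + p * atan (tau / a) - tau * (T ^ 2 / 2) in
  is_derive (fun tau => normalized_moment k alpha a tau T) tau
    (exp (p * (ln (a ^ 2 + tau ^ 2) / 2)) / (2 * (a ^ 2 + tau ^ 2))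
     * (T ^ (k + 1) * exp (- (a * (T ^ 2 / 2))))
     * (tau * cos Theta - a * sin Theta)).
Proof.
intros p Theta.
set (N := fun tau => exp (p * (ln (a ^ 2 + tau ^ 2) / 2))).
set (Th := fun tau u => alpha + p * atan (tau / a) - tau * (u ^ 2 / 2)).
set (f := fun tau u => N tau * (exp (- (a * (u ^ 2 / 2))) * cos (Th tau u) * u ^ k)).
set (df := fun tau u => N tau * exp (- (a * (u ^ 2 / 2))) * u ^ k *
   (p * tau / (a ^ 2 + tau ^ 2) * cos (Th tau u)
    - (p * a / (a ^ 2 + tau ^ 2) - u ^ 2 / 2) * sin (Th tau u))).
assert (hD : forall tau, 0 < a ^ 2 + tau ^ 2) by (intros; nra).
assert (hdf : forall tau u, is_derive (fun tau => f tau u) tau (df tau u)).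
{ intros tau0 u. specialize (hD tau0).
  unfold f, df, N, Th; auto_derive.
  - repeat split; lra.
  - pose (E := exp (- (a * (u ^ 2 / 2)))).
    pose (c := cos (Th tau0 u)). pose (s := sin (Th tau0 u)).
    change (p * (1 * ((1 + 1) * (tau0 * 1)) * / (a ^ 2 + tau0 ^ 2) * / 2)
        * N tau0 * (E * c * u ^ k)
      + N tau0 * (E * ((p * (1 * / a * / (1 + (tau0 / a) ^ 2)) + - (1 * (u ^ 2 / 2)))
          * - s) * u ^ k)
      = N tau0 * E * u ^ k * (p * tau0 / (a ^ 2 + tau0 ^ 2) * c
          - (p * a / (a ^ 2 + tau0 ^ 2) - u ^ 2 / 2) * s)).
    field. split; [nra | lra]. }
assert (hcu : forall tau u, continuous (f tau) u).
{ intros; unfold f, Th; prove_continuous. }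
apply is_derive_ext with (fun tau => RInt (f tau) 0 T).
{ intros t; unfold normalized_moment, rotated_moment.
  apply (RInt_scal (V := R_CompleteNormedModule)), ex_RInt_cont.
  prove_continuous. }
assert (hDf : forall tau u, Derive (fun tau => f tau u) tau = df tau u).
{ intros; apply is_derive_unique, hdf. }
assert (hint : RInt (fun u => Derive (fun tau => f tau u) tau) 0 T =
   N tau / (2 * (a ^ 2 + tau ^ 2))
     * (T ^ (k + 1) * exp (- (a * (T ^ 2 / 2))))
     * (tau * cos Theta - a * sin Theta)).
{ apply is_RInt_unique.
  (* [df tau] is the derivative of [Q] in [u], and [Q] vanishes at [0]. *)
  set (Q := fun u => N tau / (2 * (a ^ 2 + tau ^ 2))
     * (u ^ (k + 1) * exp (- (a * (u ^ 2 / 2))))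
     * (tau * cos (Th tau u) - a * sin (Th tau u))).
  apply is_RInt_ext with (df tau).
  { intros; symmetry; apply hDf. }
  assert (h0 : Q 0 = 0) by (unfold Q; rewrite pow_i by lia; ring).
  change (is_RInt (df tau) 0 T (Q T)).
  replace (Q T) with (minus (Q T) (Q 0))
    by (rewrite h0; apply Rminus_0_r).
  apply (is_RInt_derive Q).
  - intros u _. unfold Q, df, Th. auto_derive; [easy |].
    pose (E := exp (- (a * (u ^ 2 / 2)))).
    pose (c := cos (Th tau u)). pose (s := sin (Th tau u)).
    change (N tau / (2 * (a ^ 2 + tau ^ 2)) *
        (1 * (INR (k + 1) * u ^ Init.Nat.pred (k + 1)) * E + u ^ (k + 1)
          * (- (a * (1 * ((1 + 1) * (u * 1)) * / 2)) * E))
        * (tau * c + - (a * s))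
      + N tau / (2 * (a ^ 2 + tau ^ 2)) * (u ^ (k + 1) * E)
        * (tau * (- (tau * (1 * ((1 + 1) * (u * 1)) * / 2)) * - s)
           + - (a * (- (tau * (1 * ((1 + 1) * (u * 1)) * / 2)) * c)))
      = N tau * E * u ^ k * (p * tau / (a ^ 2 + tau ^ 2) * c
          - (p * a / (a ^ 2 + tau ^ 2) - u ^ 2 / 2) * s)).
    replace (INR (k + 1)) with (2 * p) by (rewrite plus_INR; unfold p; simpl; field).
    replace (Init.Nat.pred (k + 1)) with k by lia.
    rewrite pow_add. specialize (hD tau). field; lra.
  - unfold df, Th; prove_continuous. }
fold p. change (exp (p * (ln (a ^ 2 + tau ^ 2) / 2))) with (N tau).
rewrite <- hint.
apply is_derive_RInt_param.
- exists (mkposreal 1 Rlt_0_1); intros y _ t _; eexists; apply hdf.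
- intros t _. apply continuity_2d_pt_ext with (f := df).
  { intros; now rewrite hDf. }
  assert (a ^ 2 + tau ^ 2 <> 0) by (specialize (hD tau); lra).
  unfold df, N, Th. simpl in hD, H |- *. prove_continuity_2d.
- exists (mkposreal 1 Rlt_0_1); intros y _. apply ex_RInt_cont, hcu.
Qed.

Lemma continuous_rotated_integrand (k : nat) (psi a tau u : R) :
  continuous
    (fun u => exp (- (a * (u ^ 2 / 2))) * cos (psi - tau * (u ^ 2 / 2)) * u ^ k) u.
Proof. prove_continuous. Qed.

(** The prefactor [a^p = (sqrt a)^(k + 1)] supplies the Jacobian and the [k] factors
    [sqrt a] of the substitution [v = sqrt a * u]. *)
Lemma normalized_moment_0 (k : nat) (alpha a T : R) (ha : 0 < a) :
  normalized_moment k alpha a 0 T = cos alpha * gauss_moment k (sqrt a * T).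
Proof.
assert (hs : sqrt a ^ 2 = a) by (apply pow2_sqrt; lra).
assert (hm : sqrt a ^ (k + 1) = exp ((INR k + 1) / 2 * (ln (a ^ 2 + 0 ^ 2) / 2))).
{ rewrite sqrt_pow_Rpower by easy; unfold Rpower; f_equal.
  replace (a ^ 2 + 0 ^ 2) with (a ^ 2) by ring.
  rewrite ln_pow, plus_INR by easy; simpl; field. }
unfold normalized_moment, rotated_moment, gauss_moment; rewrite <- hm.
replace (alpha + (INR k + 1) / 2 * atan (0 / a)) with alpha
  by (unfold Rdiv; rewrite (Rmult_0_l (/ a)), atan_0; ring).
assert (hsub : RInt (fun u => sqrt a *
    (exp (- ((sqrt a * u + 0) ^ 2 / 2)) * (sqrt a * u + 0) ^ k)) 0 T
  = gauss_moment k (sqrt a * T)).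
{ pose proof (RInt_comp_lin (V := R_CompleteNormedModule)
    (fun u => exp (- (u ^ 2 / 2)) * u ^ k) (sqrt a) 0 0 T) as hlin.
  replace (sqrt a * 0 + 0) with 0 in hlin by ring.
  rewrite Rplus_0_r in hlin.
  apply hlin, ex_RInt_cont, continuous_gauss_integrand. }
change (sqrt a ^ (k + 1) * RInt (fun u => exp (- (a * (u ^ 2 / 2)))
    * cos (alpha - 0 * (u ^ 2 / 2)) * u ^ k) 0 T
  = cos alpha * gauss_moment k (sqrt a * T)).
rewrite <- hsub.
etransitivity.
{ symmetry. apply (RInt_scal (V := R_CompleteNormedModule)), ex_RInt_cont.
  apply continuous_rotated_integrand. }
etransitivity.
2: { apply (RInt_scal (V := R_CompleteNormedModule)), ex_RInt_cont.
  prove_continuous. }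
apply RInt_ext; intros u _; unfold scal; simpl; unfold mult; simpl.
change (u * (u * 1)) with (u ^ 2).
rewrite !Rplus_0_r, Rmult_0_l, Rminus_0_r.
replace (sqrt a * u * (sqrt a * u * 1)) with (sqrt a ^ 2 * u ^ 2) by ring.
rewrite hs, pow_add, Rpow_mult_distr.
unfold Rdiv; rewrite (Rmult_assoc a). ring.
Qed.

(** The limit depends on neither [a] nor [b]: moving from [a] to [a + i b] changes
    the moment by a boundary term that is uniformly Gaussian small, by the mean value
    theorem. *)
Lemma normalized_moment_lim (k : nat) (alpha a b L : R) (ha : 0 < a) :
  is_lim (gauss_moment k) p_infty L ->
  is_lim (normalized_moment k alpha a b) p_infty (cos alpha * L).
Proof.
intros hL.
set (p := (INR k + 1) / 2).
assert (hp : 0 < p) by (unfold p; pose proof (pos_INR k); lra).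
set (K := exp (p * (ln (a ^ 2 + b ^ 2) / 2)) / (2 * a ^ 2) * (Rabs b + a) * Rabs b).
assert (hdiff : is_lim
   (fun T => normalized_moment k alpha a b T - normalized_moment k alpha a 0 T) p_infty 0).
{ apply is_lim_0_le with (2 := gauss_tail_lim (k + 1) a K ha).
  intros T hT.
  destruct (MVT_gen (fun tau => normalized_moment k alpha a tau T) 0 b
    _ (fun tau _ => is_derive_normalized_moment k alpha a tau T ha)) as [c [hc ->]].
  { intros x _; apply continuity_pt_filterlim,
      (@ex_derive_continuous R_AbsRing R_NormedModule
         (fun tau => normalized_moment k alpha a tau T) x).
    eexists; exact (is_derive_normalized_moment k alpha a x T ha). }
  fold p.
  set (E := T ^ (k + 1) * exp (- (a * (T ^ 2 / 2)))).
  assert (hE : 0 <= E).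
  { apply Rmult_le_pos; [apply pow_le; lra | apply Rlt_le, exp_pos]. }
  assert (hcb : Rabs c <= Rabs b).
  { unfold Rmin, Rmax in hc; destruct (Rle_dec 0 b); unfold Rabs;
      destruct (Rcase_abs c), (Rcase_abs b); lra. }
  assert (hcb2 : c ^ 2 <= b ^ 2).
  { rewrite <- (pow2_abs c), <- (pow2_abs b). apply pow_incr; split; [apply Rabs_pos | easy]. }
  rewrite Rminus_0_r, !Rabs_mult, (Rabs_pos_eq E) by easy.
  replace (K * E) with (exp (p * (ln (a ^ 2 + b ^ 2) / 2)) / (2 * a ^ 2) * E
    * (Rabs b + a) * Rabs b) by (unfold K; ring).
  apply Rmult_le_compat_r; [apply Rabs_pos |].
  apply Rmult_le_compat; [| apply Rabs_pos | |].
  - apply Rmult_le_pos; [apply Rabs_pos | easy].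
  - apply Rmult_le_compat_r; [easy |].
    rewrite Rabs_pos_eq
      by (apply Rlt_le, Rdiv_lt_0_compat; [apply exp_pos | nra]).
    apply Rmult_le_compat; [apply Rlt_le, exp_pos | | |].
    + apply Rlt_le, Rinv_0_lt_compat; nra.
    + apply exp_le_exp, Rmult_le_compat_l; [lra |].
      apply Rmult_le_compat_r; [lra |]. apply ln_le; nra.
    + apply Rinv_le_contravar; nra.
  - apply Rle_trans with (1 := Rabs_triang _ _).
    rewrite Rabs_Ropp, !Rabs_mult, (Rabs_pos_eq a) by lra.
    set (Th := alpha + p * atan (c / a) - c * (T ^ 2 / 2)).
    pose proof (COS_bound Th). pose proof (SIN_bound Th).
    assert (Rabs (cos Th) <= 1) by (apply Rabs_le; lra).
    assert (Rabs (sin Th) <= 1) by (apply Rabs_le; lra).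
    pose proof (Rabs_pos c). pose proof (Rabs_pos (cos Th)).
    pose proof (Rabs_pos (sin Th)). nra. }
apply is_lim_ext with (fun T =>
   (normalized_moment k alpha a b T - normalized_moment k alpha a 0 T)
   + cos alpha * gauss_moment k (sqrt a * T)).
{ intros T; rewrite <- normalized_moment_0 by easy. ring. }
replace (Finite (cos alpha * L)) with (Rbar_plus 0 (cos alpha * L))
  by (simpl; f_equal; ring).
apply is_lim_plus'; [exact hdiff |].
apply (is_lim_scal_l _ (cos alpha) p_infty L).
apply is_lim_comp with p_infty; [exact hL | | now exists 0].
assert (hs : 0 < sqrt a) by now apply sqrt_lt_R0.
apply is_lim_spec; intros M; exists (M / sqrt a); intros x hx.
apply Rlt_div_l in hx; lra.
Qed.

(** * Asymptotics of the spherical integral *)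

(** For [s = a + i b], the real part of
    [exp (i psi) int_0^PI exp (- s r (1 - cos t)) (sin t)^k dt]. *)
Definition sphere_integral (k : nat) (psi a b r : R) : R :=
  RInt (fun t => exp (- (a * (r * (1 - cos t))))
                 * cos (psi - b * (r * (1 - cos t))) * sin t ^ k) 0 PI.

Lemma sphere_integral_lim (k : nat) (alpha a b L : R) (ha : 0 < a) :
  is_lim (gauss_moment k) p_infty L ->
  let p := (INR k + 1) / 2 in
  is_lim (fun rho => exp (p * (ln (a ^ 2 + b ^ 2) / 2))
     * (rho ^ (k + 1) * sphere_integral k (alpha + p * atan (b / a)) a b (rho ^ 2)))
    p_infty (cos alpha * L).
Proof.
intros hL p.
set (psi := alpha + p * atan (b / a)).
set (N := exp (p * (ln (a ^ 2 + b ^ 2) / 2))).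
set (D := fun rho => rho ^ (k + 1) * sphere_integral k psi a b (rho ^ 2)
   - rotated_moment k psi a b (2 * rho)).
assert (hD : is_lim D p_infty 0).
{ apply (laplace_reduction (fun x => exp (- (a * x)) * cos (psi - b * x)) a k ha).
  - prove_continuous.
  - intros x _. rewrite Rabs_mult, (Rabs_pos_eq (exp _)) by apply Rlt_le, exp_pos.
    rewrite <- Rmult_1_r. apply Rmult_le_compat_l; [apply Rlt_le, exp_pos |].
    apply Rabs_le, COS_bound. }
apply is_lim_ext with (fun rho => N * D rho + normalized_moment k alpha a b (2 * rho)).
{ intros rho; unfold normalized_moment, D; fold p psi N; ring. }
replace (Finite (cos alpha * L)) with (Finite (N * 0 + cos alpha * L)) by (f_equal; ring).
apply is_lim_plus'.
- now apply (is_lim_scal_l D N p_infty 0).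
- apply is_lim_comp with p_infty;
    [now apply normalized_moment_lim | | now exists 0].
  apply is_lim_spec; intros M; exists (M / 2); intros x hx; lra.
Qed.

Lemma ex_RInt_sphere (k : nat) (psi a b r x y : R) :
  ex_RInt (fun t => exp (- (a * (r * (1 - cos t))))
                 * cos (psi - b * (r * (1 - cos t))) * sin t ^ k) x y.
Proof. apply ex_RInt_cont; prove_continuous. Qed.

Lemma sphere_integral_shift (k : nat) (psi chi a b r : R) :
  sphere_integral k (psi + chi) a b r
  = cos psi * sphere_integral k chi a b r
    - sin psi * sphere_integral k (chi - PI / 2) a b r.
Proof.
apply is_RInt_unique.
pose proof (is_RInt_minus _ _ _ _ _ _
  (is_RInt_scal _ _ _ (cos psi) _ (RInt_correct (V := R_CompleteNormedModule)
     _ _ _ (ex_RInt_sphere k chi a b r 0 PI)))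
  (is_RInt_scal _ _ _ (sin psi) _ (RInt_correct (V := R_CompleteNormedModule)
     _ _ _ (ex_RInt_sphere k (chi - PI / 2) a b r 0 PI)))) as h.
apply is_RInt_ext with (2 := h).
intros t _; unfold minus, plus, opp, scal; simpl; unfold mult; simpl.
set (x := b * (r * (1 - cos t))).
replace (psi + chi - x) with (psi + (chi - x)) by ring.
replace (chi - PI / 2 - x) with (- (PI / 2 - (chi - x))) by ring.
rewrite cos_plus, cos_neg, cos_shift. ring.
Qed.

(** The pair on the left is the complex number whose real parts, after rotation by
    [psi], are the values of [sphere_integral]; multiplying it by a complex
    exponential therefore shifts the phase. *)
Lemma Cexp_mult_sphere (k : nat) (x psi a b r : R) :
  (Cexp (x, psi) * (sphere_integral k 0 a b r, sphere_integral k (- (PI / 2)) a b r))%C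
  = (exp x * sphere_integral k psi a b r,
     exp x * sphere_integral k (- (PI / 2) + psi) a b r).
Proof.
rewrite <- (Rplus_0_r psi) at 2.
rewrite (Rplus_comm (- (PI / 2))).
rewrite (sphere_integral_shift k psi 0).
replace (psi + - (PI / 2)) with ((psi - PI / 2) + 0) by ring.
rewrite (sphere_integral_shift k (psi - PI / 2) 0).
replace (0 - PI / 2) with (- (PI / 2)) by ring.
replace (psi - PI / 2) with (- (PI / 2 - psi)) by ring.
rewrite cos_neg, sin_neg, cos_shift, sin_shift.
unfold Cexp, Cmult; simpl. f_equal; ring.
Qed.

Lemma RInt_Cexp_cos (k : nat) (s : C) (r : R) :
  RInt (V := C_R_CompleteNormedModule)
    (fun t : R => (Cexp (s * RtoC r * RtoC (cos t)) * RtoC (sin t ^ k))%C) 0 PI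
  = (Cexp (s * RtoC r)
     * (sphere_integral k 0 (Re s) (Im s) r,
        sphere_integral k (- (PI / 2)) (Re s) (Im s) r))%C.
Proof.
destruct s as [a b].
replace ((a, b) * RtoC r)%C with ((a * r, b * r) : C)
  by (unfold Cmult, RtoC; simpl; f_equal; ring).
rewrite Cexp_mult_sphere.
simpl Re; simpl Im.
apply is_RInt_unique.
apply (is_RInt_fct_extend_pair (U := R_NormedModule) (V := R_NormedModule)).
- apply is_RInt_ext with (2 := is_RInt_scal _ _ _ (exp (a * r)) _
    (RInt_correct (V := R_CompleteNormedModule) _ _ _ (ex_RInt_sphere k (b * r) a b r 0 PI))).
  intros t _; unfold scal; simpl; unfold mult; simpl.
  replace (a * r * cos t - b * r * 0)
    with (a * r + - (a * (r * (1 - cos t)))) by ring.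
  replace (a * r * 0 + b * r * cos t) with (b * r - b * (r * (1 - cos t))) by ring.
  rewrite exp_plus; ring.
- apply is_RInt_ext with (2 := is_RInt_scal _ _ _ (exp (a * r)) _
    (RInt_correct (V := R_CompleteNormedModule) _ _ _
      (ex_RInt_sphere k (- (PI / 2) + b * r) a b r 0 PI))).
  intros t _; unfold scal; simpl; unfold mult; simpl.
  replace (a * r * cos t - b * r * 0)
    with (a * r + - (a * (r * (1 - cos t)))) by ring.
  replace (a * r * 0 + b * r * cos t) with (b * r - b * (r * (1 - cos t))) by ring.
  replace (- (PI / 2) + b * r - b * (r * (1 - cos t)))
    with (- (PI / 2 - (b * r - b * (r * (1 - cos t))))) by ring.
  rewrite cos_neg, cos_shift, exp_plus; ring.
Qed.

(** * Complex powers and the theorem *)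

Lemma Carg_atan (z : C) : 0 < Re z -> Carg z = atan (Im z / Re z).
Proof.
intros hz; destruct z as [x y]; simpl in hz |- *.
assert (hcos : x / Cmod (x, y) = cos (atan (y / x))).
{ rewrite cos_atan; unfold Cmod; simpl fst; simpl snd.
  replace (x ^ 2 + y ^ 2) with (x ^ 2 * (1 + Rsqr (y / x)))
    by (unfold Rsqr; field; lra).
  pose proof (Rle_0_sqr (y / x)).
  rewrite sqrt_mult, sqrt_pow2 by nra.
  field. split; [apply Rgt_not_eq, sqrt_lt_R0 |]; lra. }
unfold Carg; simpl Re; simpl Im; rewrite hcos.
pose proof (atan_bound (y / x)) as hb.
destruct (Rle_dec 0 y) as [hy | hy].
- apply acos_cos; split; [| lra].
  rewrite <- atan_0. destruct (Req_dec y 0) as [-> | hy0].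
  + unfold Rdiv; rewrite Rmult_0_l; lra.
  + apply Rlt_le, atan_increasing, Rdiv_lt_0_compat; lra.
- assert (atan (y / x) < 0).
  { rewrite <- atan_0; apply atan_increasing. apply Rdiv_neg_pos; lra. }
  rewrite <- (cos_neg (atan (y / x))), acos_cos; lra.
Qed.

(** A positive dilation does not change the principal argument, so the power of [r]
    splits off and the remaining factor is [(a + i b)^p] in polar form. *)
Lemma Cpower_scal (a b r p : R) (ha : 0 < a) (hr : 0 < r) :
  Cpower ((a, b) * RtoC r) (RtoC p)
  = (RtoC (Rpower r p) * Cexp (p * (ln (a ^ 2 + b ^ 2) / 2), p * atan (b / a))%R)%C.
Proof.
assert (hz : ((a, b) * RtoC r)%C = (r * a, r * b))
  by (unfold Cmult, RtoC; simpl; f_equal; ring).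
assert (hD : 0 < a ^ 2 + b ^ 2) by nra.
unfold Cpower, Clog; rewrite Carg_atan by (rewrite hz; simpl; nra).
rewrite hz; simpl Re; simpl Im.
replace (r * b / (r * a)) with (b / a) by (field; lra).
replace (ln (Cmod (r * a, r * b))) with (ln r + ln (a ^ 2 + b ^ 2) / 2).
- unfold Cexp, Cmult, RtoC, Rpower; simpl.
  replace (p * (ln r + ln (a * (a * 1) + b * (b * 1)) / 2) - 0 * atan (b / a))
    with (p * ln r + p * (ln (a * (a * 1) + b * (b * 1)) / 2)) by ring.
  replace (p * atan (b / a) + 0 * (ln r + ln (a * (a * 1) + b * (b * 1)) / 2))
    with (p * atan (b / a)) by ring.
  rewrite exp_plus; f_equal; ring.
- unfold Cmod; simpl fst; simpl snd.
  replace ((r * a) ^ 2 + (r * b) ^ 2) with (r ^ 2 * (a ^ 2 + b ^ 2)) by ring.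
  rewrite sqrt_mult, sqrt_pow2 by nra.
  rewrite ln_mult by (try apply sqrt_lt_R0; lra).
  rewrite <- Rpower_sqrt by easy. unfold Rpower; rewrite ln_exp; field.
Qed.

Lemma Cexp_neq_0 (z : C) : Cexp z <> RtoC 0.
Proof.
intros h; injection h as h1 h2.
pose proof (exp_pos (Re z)).
pose proof (sin2_cos2 (Im z)) as hsc; unfold Rsqr in hsc. nra.
Qed.

Theorem theorem4p1 (n : nat) (s : C) (hn : (1 < n)%nat) (hs : 0 < Re s) :
  asymp_equiv
    (fun r : R => phi n r s)
    (fun r : R =>
       (RtoC (Gamma (INR n / 2) * Rpower 2 ((INR n - 3) / 2) / sqrt PI)
        * (Cexp (s * RtoC r)
           / Cpower (s * RtoC r) (RtoC ((INR n - 1) / 2))))%C).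
Proof.
destruct n as [| [| k]]; [lia | lia |].
destruct s as [a b]; simpl in hs.
set (p := (INR k + 1) / 2).
replace ((INR (S (S k)) - 1) / 2) with p by (rewrite !S_INR; unfold p; field).
destruct (Gamma_gauss_moment k) as [L [hL [hlim hG]]].
(* [Gamma (n / 2)] occurs on both sides and, being nonzero, cancels. *)
destruct (Gamma_gauss_moment (S k)) as [L' [hL' [_ hG']]].
assert (hG1 : Gamma (INR (S (S k)) / 2) <> 0).
{ rewrite S_INR; intros h; rewrite h in hG'; lra. }
set (F := fun alpha rho => exp (p * (ln (a ^ 2 + b ^ 2) / 2))
   * (rho ^ (k + 1) * sphere_integral k (alpha + p * atan (b / a)) a b (rho ^ 2))).
assert (hF : forall alpha, is_lim (fun r => / L * F alpha (sqrt r)) p_infty (cos alpha)).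
{ intros alpha.
  replace (Finite (cos alpha)) with (Rbar_mult (/ L) (cos alpha * L))
    by (simpl; f_equal; field; lra).
  apply is_lim_scal_l.
  apply (is_lim_comp (F alpha) sqrt _ _ p_infty);
    [exact (sphere_integral_lim k alpha a b L hs hlim) | | now exists 0].
  apply filterlim_sqrt_p. }
unfold asymp_equiv.
apply filterlim_ext_loc with
  (fun r => (/ L * F 0 (sqrt r), / L * F (- (PI / 2)) (sqrt r)) : C).
  (* Up to the constant [/ L], the quotient is [(s r)^p J]. *)
- exists 0; intros r hr.
  unfold phi.
  replace (S (S k) - 2)%nat with k by lia.
  rewrite RInt_Cexp_cos; simpl Re; simpl Im.
  rewrite Cpower_scal by easy.
  replace (Rpower r p) with (sqrt r ^ (k + 1))
    by (rewrite sqrt_pow_Rpower, plus_INR by easy; reflexivity).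
  replace ((INR (S (S k)) - 1) / 2) with p by (rewrite !S_INR; unfold p; field).
  replace ((INR (S (S k)) - 3) / 2) with ((INR k - 1) / 2)
    by (rewrite !S_INR; field).
  fold p in hG.
  set (J := (sphere_integral k 0 a b r, sphere_integral k (- (PI / 2)) a b r) : C).
  set (z := ((a, b) * RtoC r)%C).
  set (P := Cexp (p * (ln (a ^ 2 + b ^ 2) / 2), p * atan (b / a))).
  transitivity (RtoC (/ L * sqrt r ^ (k + 1)) * (P * J))%C.
  + unfold P, J; rewrite Cexp_mult_sphere.
    unfold F; rewrite pow2_sqrt by lra.
    rewrite Rplus_0_l. unfold Cmult, RtoC; simpl; f_equal; ring.
  + assert (hPz : P <> RtoC 0) by apply Cexp_neq_0.
    assert (hez : Cexp z <> RtoC 0) by apply Cexp_neq_0.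
    assert (hGp : Gamma p <> 0) by (intros h; rewrite h in hG; lra).
    assert (h2 : 0 < Rpower 2 ((INR k - 1) / 2)) by apply exp_pos.
    assert (hpi : 0 < sqrt PI) by apply sqrt_lt_R0, PI_RGT_0.
    assert (hsr : 0 < sqrt r ^ (k + 1)) by now apply pow_lt, sqrt_lt_R0.
    rewrite <- hG.
    set (G1 := Gamma (INR (S (S k)) / 2)) in *.
    set (G2 := Gamma p) in *.
    set (R2 := Rpower 2 ((INR k - 1) / 2)) in *.
    set (q := sqrt r ^ (k + 1)) in *.
    rewrite !RtoC_mult, !RtoC_div, !RtoC_inv, !RtoC_mult
      by (try apply Rmult_integral_contrapositive; lra).
    assert (forall x, x <> 0 -> RtoC x <> RtoC 0)
      by (intros x hx h; apply hx; now apply RtoC_inj).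
    field. repeat split; auto; try (apply H; lra).
- apply (filterlim_filter_le_2 (G := filter_prod (locally 1) (locally 0))).
  { intros Q [d hd]; exists (ball 1 d) (ball 0 d);
      [now exists d .. |]. intros x y hx hy; apply hd; now split. }
  apply filterlim_pair.
  + rewrite <- cos_0. apply hF.
  + replace 0 with (cos (- (PI / 2))) by (rewrite cos_neg; apply cos_PI2).
    apply hF.
Qed.
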